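(* Let $G=Q:L$ be a biextraspecial group with dent space $(\mathcal D,q)$, let $t\in L$ be an involution, let $R=C_Q(t)$, $Z_t=Z(R)$ and $\bar R=R/Z_t$ with quadratic form $q_t$ given by $q_t(Z_tx)=x^2\in Z_t\cong GF(2)$. Then the map $\mathcal D\to\bar R$ given by $D=\langle x,y,Z\rangle\mapsto Z_t x$ (where $x,y$ belong to a standard basis of the dent $D$) and $0_{\mathcal D}\mapsto Z_t$ is a bijective linear isometry. That is, $(\mathcal D,q)$ and $(\bar R,q_t)$ are isometric orthogonal spaces.
   Context: Biextraspecial groups. $L_2(2)=SL_2(2)\cong S_3$; its natural module is $GF(2)^2$. For $m\ge 1$, a finite group $G$ is a biextraspecial group of rank $m$ if: (B1) $G$ has a normal $2$-subgroup $Q$ of order $2^{2+2m}$ with $G/Q\cong L_2(2)$; (B2) $Z=Z(Q)$, with the conjugation action of $G/Q$, is the natural module; (B3) $Q/Z$ is elementary abelian of order $2^{2m}$ and all its composition factors as a module for $G/Q$ over $GF(2)$ are natural modules. Such $G$ splits over $Q$; $L\cong L_2(2)$ is a fixed complement, $G=Q:L$. Exponents denote conjugation. Dents. A dent is a normal subgroup $D$ of $G$ with $Z<D<Q$ such that $D/Z$ is an irreducible $L$-submodule of $Q/Z$. Every dent is isomorphic to $2^4$ (singular) or $4^2=C_4\times C_4$ (non-singular). For distinct dents $D_1,D_2$, the diagonal dent $D_1+D_2$ is the full preimage in $Q$ of $\{u\cdot u\varphi:u\in D_1/Z\}$, with $\varphi:D_1/Z\to D_2/Z$ the unique $L$-isomorphism.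 The dent space $\mathcal D$ is the set of all dents together with a formal zero $0_{\mathcal D}$, with $D+D=0_{\mathcal D}$; this is a $GF(2)$-vector space. The form $\beta(D_1,D_2)$ is $0$ if $[D_1,D_2]=1$ and $1$ otherwise; the quadratic form $q$ is $q(D)=0$ if $D$ is singular, $1$ if non-singular, $q(0_{\mathcal D})=0$. Standard bases. Write $L=\langle s,t\rangle$ with $s$ of order $3$ and $t$ the given involution, and $Z=\langle a,b\rangle$ with $a^t=a\neq 1$, $b=a^s$. A standard basis of a dent $D$ consists of $a,b$ and elements $x,y\in D$ with $D=\langle x,y,Z\rangle$ such that: if $D$ is singular, $x^t=x$, $y^t=xy$, $x^s=y$, $y^s=xy$; if $D$ is non-singular, $x^t=x$, $y^t=x^{-1}y^{-1}$, $x^s=y$, $y^s=x^{-1}y^{-1}$ (and then $x^2=a$, $y^2=b$). The group $R$ is extraspecial with centre $Z_t=\langle a\rangle$ of order $2$, identified with $GF(2)$; the bilinear form associated with $q_t$ is $(Z_tx,Z_ty)\mapsto[x,y]$. *)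

(* Defs.v *)
From HB Require Import structures.
From mathcomp Require Import all_boot all_order all_algebra all_fingroup all_solvable.

Set Implicit Arguments.
Unset Strict Implicit.
Unset Printing Implicit Defensive.

Import GroupScope.

(* L_2(2) = SL_2(2) *)
Definition SL2_2 : {set {'GL_2(2)}} :=
  [set g : {'GL_2(2)} | (\det (GLval g) == 1)%R].

Section Biextraspecial.

Variable gT : finGroupType.
Implicit Types (G Q L D U V R : {group gT}) (s t a b x y : gT).

(* U / V, with G / Q acting by conjugation, is the natural module GF(2)^2,
   written as row vectors since conjugation is a right action. *)
Definition natural_section G Q U V : Prop :=
  exists (f : {morphism G / Q >-> {'GL_2(2)}})
         (h : {morphism U / V >-> 'rV['F_2]_2}),
    [/\ isom (G / Q) SL2_2 f,
        isom (U / V) [set: 'rV['F_2]_2] h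
      & forall u g, u \in U -> g \in G ->
          h (coset V (u ^ g)) = (h (coset V u) *m GLval (f (coset Q g)))%R].

(* The composition factors of the G / Q-module Q / Z(Q) are the chief factors
   U / V of G with Z(Q) <= V < U <= Q. *)
Definition biextraspecial (m : nat) G Q : Prop :=
  [/\ 0 < m,
      [/\ Q <| G, 2.-group Q, #|Q| = (2 ^ (2 + 2 * m))%N
        & G / Q \isog SL2_2],
      natural_section G Q 'Z(Q) 1
    & [/\ 2.-abelem (Q / 'Z(Q)), #|Q / 'Z(Q)| = (2 ^ (2 * m))%N
        & forall U V, 'Z(Q) \subset V -> U \subset Q ->
            chief_factor G V U -> natural_section G Q U V]].

Definition is_dent G Q L D : bool :=
  [&& D <| G, 'Z(Q) \proper D, D \proper Q
    & acts_irreducibly L (D / 'Z(Q)) ('J / 'Z(Q))].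

Definition dent G Q L := {D : {group gT} | is_dent G Q L D}.

Definition singular D : bool := D \isog [set: 'rV['F_2]_4].
Definition nonsingular D : bool := D \isog [set: 'Z_4 * 'Z_4].

Definition dent_iso Q L D1 D2
    (phi : {ffun coset_of 'Z(Q) -> coset_of 'Z(Q)}) : bool :=
  misom (D1 / 'Z(Q)) (D2 / 'Z(Q)) phi &&
  [forall u in D1 / 'Z(Q), forall l in L,
     phi (('J / 'Z(Q))%act u l) == ('J / 'Z(Q))%act (phi u) l].

(* The L-isomorphism phi is unique on D1 / Z(Q) when D1 and D2 are dents. *)
Definition diagonal_set Q L D1 D2 : {set gT} :=
  [set z in Q | [exists phi, dent_iso L D1 D2 phi &&
     (coset 'Z(Q) z \in [set u * phi u | u in D1 / 'Z(Q)])]].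

(* For dents D1 != D2 the set diagonal_set Q L D1 D2 is already a subgroup. *)
Definition diagonal Q L D1 D2 : {group gT} :=
  <<diagonal_set Q L D1 D2>>%G.

(* None is the formal zero. *)
Definition dent_space G Q L := option (dent G Q L).

(* For D1 != D2, insub packs the diagonal, which is a dent, as an element
   Some _ of the dent space. *)
Definition dent_add G Q L (d1 d2 : dent_space G Q L) : dent_space G Q L :=
  match d1, d2 with
  | None, _ => d2
  | _, None => d1
  | Some D1, Some D2 =>
      if D1 == D2 then None else insub (diagonal Q L (val D1) (val D2))
  end.

Definition dent_q G Q L (d : dent_space G Q L) : 'F_2 :=
  match d with
  | None => 0%R
  | Some D => if singular (val D) then 0%R else 1%R
  end.

(* In the non-singular case x ^+ 2 = a and y ^+ 2 = b follow. *)
Definition standard_basis Q s t D a b x y : Prop :=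
  [/\ [/\ 'Z(Q) = <<[set a; b]>>, a ^ t = a, a <> 1 & b = a ^ s],
      [/\ x \in D, y \in D & D :=: <<[set x; y] :|: 'Z(Q)>>],
      singular D ->
        [/\ x ^ t = x, y ^ t = x * y, x ^ s = y & y ^ s = x * y]
    & nonsingular D ->
        [/\ x ^ t = x, y ^ t = x^-1 * y^-1, x ^ s = y & y ^ s = x^-1 * y^-1]].

(* q_t (Z(R) x) = x ^+ 2, where Z(R), of order 2, is identified with GF(2);
   see q_tE for the independence of the representative. *)
Definition q_t R (v : coset_of 'Z(R)) : 'F_2 :=
  if repr v ^+ 2 == 1 then 0%R else 1%R.

Lemma q_tE R x : #|'Z(R)| = 2 -> x \in R ->
  q_t (coset 'Z(R) x) = if x ^+ 2 == 1 then 0%R else 1%R.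
Proof.
move=> oZ Rx; rewrite /q_t.
have nZx : x \in 'N('Z(R)) by apply: subsetP Rx; rewrite normal_norm ?center_normal.
have : repr (coset 'Z(R) x) \in coset 'Z(R) x by rewrite mem_repr_coset.
rewrite val_coset // => /rcosetP[z Zz ->].
have z2 : z ^+ 2 = 1 by rewrite -oZ expg_cardG.
have /centerP[_ cz] := Zz.
by rewrite expgMn ?z2 ?mul1g //; apply: cz.
Qed.

End Biextraspecial.

(* Main.v *)
Require Import Defs.
From HB Require Import structures.
From mathcomp Require Import all_boot all_order all_algebra all_fingroup all_solvable.
From mathcomp Require Import mxabelem.

Set Implicit Arguments.
Unset Strict Implicit.
Unset Printing Implicit Defensive.

Import GroupScope.

(* Put Z = Z(Q) and R = C_Q(t). Both Z and Q/Z are elementary abelian 2-groups on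
   which s acts without nontrivial fixed points; on such a module 1 + s + s^2 = 0,
   every nontrivial submodule contains a nontrivial vector x fixed by t, and
   <x, x^s> is then a natural module in which x is the only nontrivial vector
   fixed by t. Applied to Q/Z this gives a bijection between dents and nontrivial
   t-fixed vectors of Q/Z, and these lift to R because Z is free as a <t>-module.
   Since s fixes no nontrivial element of Z, every x in Q commutes with x^s and
   satisfies x x^s x^(s^2) = 1 exactly, so a dent <x, x^s, Z> is abelian, and its
   isomorphism type is read off from x^2. The same fixed-point argument shows that
   Z(R) has order 2. *)

(** * Elementary abelian 2-groups on which [s] and [t] act as $S_3$, with [s] fixed-point-free *)

Section NaturalModule.

Variables (hT : finGroupType) (A : {group hT}) (s t : hT).
Hypotheses (abelA : 2.-abelem A) (nAs : s \in 'N(A)) (nAt : t \in 'N(A)).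
Hypotheses (s3 : s ^+ 3 = 1) (t2 : t ^+ 2 = 1) (st : s ^ t = s^-1).
Hypothesis fpf : forall x, x \in A -> x ^ s = x -> x = 1.

Implicit Types (x y u : hT) (B : {group hT}).

Lemma abelem2_commute x y : x \in A -> y \in A -> commute x y.
Proof. by case/and3P: abelA => _ cAA _ Ax Ay; apply: (centsP cAA). Qed.

Lemma abelem2_sq x : x \in A -> x * x = 1.
Proof.
by move: abelA; rewrite abelemE // => /andP[_ /exponentP A2] /A2.
Qed.

Lemma conj_sss x : ((x ^ s) ^ s) ^ s = x.
Proof. by rewrite -!conjgM mulgA -(expgSr s 1) -expgSr s3 conjg1. Qed.

Lemma conj_tt x : (x ^ t) ^ t = x.
Proof. by rewrite -!conjgM -(expgSr t 1) t2 conjg1. Qed.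

Lemma conj_st x : (x ^ s) ^ t = ((x ^ t) ^ s) ^ s.
Proof.
rewrite -!conjgM; congr (x ^ _); rewrite conjgC st; congr (_ * _).
by apply: (mulgI s); rewrite mulgV mulgA -(expgSr s 1) -expgSr s3.
Qed.

Lemma memJs x : x \in A -> x ^ s \in A. Proof. by rewrite memJ_norm. Qed.

Lemma memJt x : x \in A -> x ^ t \in A. Proof. by rewrite memJ_norm. Qed.

(** The product [x * x ^ s * (x ^ s) ^ s] is permuted cyclically by [s], hence fixed, hence trivial;
    in exponent 2 this can be solved for the last factor. *)
Lemma conj_ss x : x \in A -> (x ^ s) ^ s = x * x ^ s.
Proof.
move=> Ax; have Axs := memJs Ax; have Axss := memJs Axs.
suff tr1 : x * x ^ s * (x ^ s) ^ s = 1.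
  apply: (mulgI (x * x ^ s)); rewrite tr1.
  by rewrite abelem2_sq // groupM.
have Axx := groupM Ax Axs.
apply: fpf; first exact: groupM.
by rewrite 2!conjMg conj_sss (abelem2_commute _ Ax) ?(groupM Axs) // mulgA.
Qed.

Lemma conj_fixed_st x : x \in A -> x ^ t = x -> (x ^ s) ^ t = x * x ^ s.
Proof. by move=> Ax xt; rewrite conj_st xt conj_ss. Qed.

(** Booleans serve as exponents so that a pair is a vector over $GF(2)$ and products of values
    correspond to componentwise xor. *)
Definition coords x (p : bool * bool) := x ^+ p.1 * (x ^ s) ^+ p.2.

Lemma coordsM x p q : x \in A ->
  coords x p * coords x q = coords x (p.1 (+) q.1, p.2 (+) q.2).
Proof.
move=> Ax; have Axs := memJs Ax; rewrite /coords /=.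
have bitM y (i j : bool) : y \in A -> y ^+ i * y ^+ j = y ^+ (i (+) j).
  by case: i; case: j => Ay; rewrite ?mulg1 ?mul1g //= abelem2_sq.
rewrite -!bitM // mulgA -[in RHS]mulgA.
rewrite -(mulgA (x ^+ p.1)) (@abelem2_commute (_ ^+ p.2)) ?groupX // !mulgA.
by rewrite -!mulgA.
Qed.

Lemma coords_mul x y p : x \in A -> y \in A ->
  coords (x * y) p = coords x p * coords y p.
Proof.
move=> Ax Ay; have [Axs Ays] := (memJs Ax, memJs Ay).
rewrite /coords (conjMg x) (expgMn _ (abelem2_commute Ax Ay)).
rewrite (expgMn _ (abelem2_commute Axs Ays)).
have cyx : commute (y ^+ p.1) ((x ^ s) ^+ p.2).
  by apply: abelem2_commute; apply: groupX.
by rewrite -!mulgA; congr (_ * _); rewrite (mulgA (y ^+ p.1)) cyx -mulgA.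
Qed.

Lemma mem_coords x p : x \in A -> coords x p \in A.
Proof. by move=> Ax; rewrite groupM ?groupX ?memJs. Qed.

Lemma coordsJs x p : x \in A -> (coords x p) ^ s = coords x (p.2, p.1 (+) p.2).
Proof.
case: p => -[] [] Ax; rewrite /coords /= ?expg0 ?expg1 ?mulg1 ?mul1g ?conj1g //.
  have Axs := memJs Ax; rewrite conjMg conj_ss //.
  by rewrite (abelem2_commute Axs (groupM Ax Axs)) -mulgA abelem2_sq ?mulg1.
by rewrite conj_ss.
Qed.

Lemma coordsJt x p : x \in A -> x ^ t = x ->
  (coords x p) ^ t = coords x (p.1 (+) p.2, p.2).
Proof.
case: p => -[] [] Ax xt;
  rewrite /coords /= ?expg0 ?expg1 ?mulg1 ?mul1g ?conj1g //.
  by rewrite conjMg xt conj_fixed_st // mulgA abelem2_sq // mul1g.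
by rewrite conj_fixed_st.
Qed.

Lemma coords_group_set x : x \in A -> group_set [set coords x p | p : bool * bool].
Proof.
move=> Ax; apply/group_setP; split.
  by apply/imsetP; exists (false, false); rewrite // /coords mulg1.
by move=> _ _ /imsetP[p _ ->] /imsetP[q _ ->]; rewrite coordsM ?imset_f.
Qed.

Definition natmod x := <<[set x; x ^ s]>>%G.

Lemma natmodE x : x \in A -> natmod x = [set coords x p | p : bool * bool] :> {set hT}.
Proof.
move=> Ax; apply/eqP; rewrite eqEsubset; apply/andP; split.
  rewrite (gen_subG _ (Group (coords_group_set Ax))); apply/subsetP=> u.
  rewrite !inE => /orP[] /eqP-> /=; apply/imsetP.
    by exists (true, false); rewrite // /coords mulg1.
  by exists (false, true); rewrite // /coords mul1g.
apply/subsetP=> _ /imsetP[p _ ->].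
by rewrite groupM ?groupX ?mem_gen // !inE eqxx ?orbT.
Qed.

Lemma natmodP x u : x \in A -> reflect (exists p, u = coords x p) (u \in natmod x).
Proof.
move=> Ax; rewrite natmodE //.
by apply: (iffP imsetP) => [[p _ ->] | [p ->]]; exists p.
Qed.

Lemma mem_natmod x : x \in natmod x.
Proof. by rewrite mem_gen // !inE eqxx. Qed.

Lemma natmod_sub x : x \in A -> natmod x \subset A.
Proof. by move=> Ax; apply/subsetP=> _ /natmodP[] // p ->; apply: mem_coords. Qed.

Lemma natmod_norms x : x \in A -> s \in 'N(natmod x).
Proof.
move=> Ax; apply/normP/eqP; rewrite eqEcard cardJg leqnn andbT.
apply/subsetP=> _ /imsetP[_ /natmodP[] // p -> ->]; rewrite coordsJs //.
by apply/natmodP => //; eexists.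
Qed.

Lemma natmod_normt x : x \in A -> x ^ t = x -> t \in 'N(natmod x).
Proof.
move=> Ax xt; apply/normP/eqP; rewrite eqEcard cardJg leqnn andbT.
apply/subsetP=> _ /imsetP[_ /natmodP[] // p -> ->]; rewrite coordsJt //.
by apply/natmodP => //; eexists.
Qed.

Lemma coords_inj x : x \in A -> x != 1 -> injective (coords x).
Proof.
move=> Ax ntx; have ntxs : x ^ s != 1 by rewrite conjg_eq1.
(* By [coordsM], two pairs with the same value have an xor with value 1, so a trivial kernel
   suffices. *)
suff kerc p : coords x p = 1 -> p = (false, false).
  move=> p q epq; have := coordsM p q Ax; rewrite epq abelem2_sq ?mem_coords //.
  by move/esym/kerc; case: p q {epq} => -[] [] [[] []].
case: p => -[] []; rewrite /coords /= ?expg0 ?expg1 ?mulg1 ?mul1g // => /eqP.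
- by rewrite -conj_ss // !conjg_eq1 (negPf ntx).
- by rewrite (negPf ntx).
by rewrite (negPf ntxs).
Qed.

Lemma card_natmod x : x \in A -> x != 1 -> #|natmod x| = 4.
Proof.
move=> Ax ntx; rewrite natmodE // card_imset; last exact: coords_inj.
by rewrite card_prod card_bool.
Qed.

(** In coordinates [t] sends $(i,j)$ to $(i+j,j)$, so a fixed vector has $j=0$. *)
Lemma natmod_fixed x u : x \in A -> x ^ t = x -> u \in natmod x ->
  u ^ t = u -> u != 1 -> u = x.
Proof.
move=> Ax xt /natmodP[] // [i j] ->; have [-> | ntx] := eqVneq x 1.
  by rewrite /coords conj1g !expg1n mulg1.
rewrite coordsJt // => /(coords_inj Ax ntx)[].
by case: i j => -[] // _; rewrite /coords /= mulg1 ?eqxx.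
Qed.

(* On the natural module with basis e, e^s (where t fixes e), s^2 (1 + t) is the
   matrix unit e |-> e, e^s |-> 0 and 1 + t is the matrix unit e |-> 0, e^s |-> e. *)
Lemma fixed_decomposition u : u \in A ->
  u = ((u ^ s) ^ s * ((u ^ s) ^ s) ^ t) * (u * u ^ t) ^ s.
Proof.
move=> Au; have Av := memJs Au; have Aw := memJs (memJt Au).
have -> : ((u ^ s) ^ s) ^ t = (u ^ t) ^ s by rewrite !conj_st conj_sss.
rewrite (conjMg u) conj_ss // -(mulgA u) -(mulgA u).
by rewrite abelem2_sq ?(groupM Av Aw) ?mulg1.
Qed.

(** Every product [y * y ^ t] is fixed by [t]. For a nontrivial [u], the products obtained from [u]
    and from [(u ^ s) ^ s] cannot both be trivial, since [fixed_decomposition] would then give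
    [u = 1]. *)
Lemma exists_fixed B : B \subset A -> s \in 'N(B) -> t \in 'N(B) -> B :!=: 1 ->
  exists x, [/\ x \in B, x ^ t = x & x != 1].
Proof.
move=> sBA nBs nBt /trivgPn[u Bu ntu]; have Au := subsetP sBA u Bu.
have Bs y : y \in B -> y ^ s \in B by rewrite memJ_norm.
have Bt y : y \in B -> y ^ t \in B by rewrite memJ_norm.
have fix_tr y : y \in B -> (y * y ^ t) ^ t = y * y ^ t.
  move=> By; rewrite conjMg conj_tt abelem2_commute ?(subsetP sBA) ?Bt //.
have [e1 | nt1] := eqVneq ((u ^ s) ^ s * ((u ^ s) ^ s) ^ t) 1; last first.
  by exists ((u ^ s) ^ s * ((u ^ s) ^ s) ^ t); rewrite nt1 groupM ?fix_tr ?Bt ?Bs.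
exists (u * u ^ t); rewrite groupM ?fix_tr ?Bt //; split=> //.
by apply: contraNneq ntu => e2; rewrite (fixed_decomposition Au) e1 e2 conj1g mulg1.
Qed.

(** An invariant nontrivial [B] contains a nontrivial [t]-fixed vector, which can only be [x], and
    [x] with its [s]-conjugate generates everything. *)
Lemma natmod_min x B : x \in A -> x ^ t = x -> B \subset natmod x ->
  s \in 'N(B) -> t \in 'N(B) -> B :!=: 1 -> B :=: natmod x.
Proof.
move=> Ax xt sBx nBs nBt ntB; apply/eqP; rewrite eqEsubset sBx.
have [y [By yt nty]] := exists_fixed (subset_trans sBx (natmod_sub Ax)) nBs nBt ntB.
have <- := natmod_fixed Ax xt (subsetP sBx y By) yt nty.
by rewrite gen_subG subUset !sub1set By memJ_norm.
Qed.

Lemma natmod_isom x y : x \in A -> x ^ t = x -> x != 1 ->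
    y \in A -> y ^ t = y -> y != 1 ->
  exists phi : {ffun hT -> hT},
    [/\ misom (natmod x) (natmod y) phi,
        {in natmod x, forall u, phi (u ^ s) = (phi u) ^ s},
        {in natmod x, forall u, phi (u ^ t) = (phi u) ^ t}
      & forall p, phi (coords x p) = coords y p].
Proof.
move=> Ax xt ntx Ay yt nty.
(* The map reads off the coordinates relative to [x], unique by [coords_inj], and rebuilds them on
   [y]; the default 1 is taken only outside [natmod x]. *)
pose phi := [ffun u => odflt 1 (omap (coords y) [pick p | u == coords x p])].
have phiE p : phi (coords x p) = coords y p.
  rewrite ffunE; case: pickP => [q /eqP/(coords_inj Ax ntx)-> // | /(_ p)].
  by rewrite eqxx.
exists phi; split=> //; last 2 first.
- by move=> _ /natmodP[] // p ->; rewrite coordsJs // !phiE coordsJs.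
- by move=> _ /natmodP[] // p ->; rewrite coordsJt // !phiE coordsJt.
apply/andP; split.
  apply/morphicP=> _ _ /natmodP[] // p -> /natmodP[] // q ->.
  by rewrite coordsM // !phiE coordsM.
have coords1 z p : z \in A -> z != 1 -> (coords z p == 1) = (p == (false, false)).
  move=> Az ntz; rewrite -(inj_eq (coords_inj Az ntz)).
  by rewrite {3}/coords mulg1.
apply/eqP/setP=> v; rewrite in_setD1; apply/imsetP/andP.
  case=> u /setD1P[ntu /natmodP[] // p def_u] ->; rewrite def_u phiE.
  split; last by apply/natmodP=> //; exists p.
  by rewrite coords1 // -(coords1 x) // -def_u.
case=> ntv /natmodP[] // p def_v; exists (coords x p); last by rewrite phiE.
rewrite in_setD1 coords1 // -(coords1 y) // -def_v ntv.
by apply/natmodP=> //; exists p.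
Qed.

End NaturalModule.

(** * Matrix computations in $SL_2(2)$ and consequences for natural sections *)

Lemma F2P (x : 'F_2) : x = 0%R \/ x = 1%R.
Proof. by case: x => -[|[|//]] i; [left | right]; apply: val_inj. Qed.

Lemma ord2P (i : 'I_2) : i = 0%R \/ i = 1%R.
Proof. exact: F2P i. Qed.

Lemma SL2_2E : SL2_2 = [set: {'GL_2(2)}].
Proof.
apply/setP=> g; rewrite !inE; apply/eqP.
case: (F2P (\det (GLval g))%R) => // det0.
by have := GL_det g; rewrite det0 eqxx.
Qed.

Lemma mulmx2E (R : nzSemiRingType) (n : nat) (A : 'M[R]_(n, 2)) (B : 'M[R]_2) i j :
  ((A *m B) i j = A i 0 * B 0 j + A i 1 * B 1 j)%R.
Proof.
rewrite mxE big_ord_recl big_ord1.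
by congr (_ + A i _ * B _ j)%R; apply: val_inj.
Qed.

Lemma det_mx2 (R : comNzRingType) (A : 'M[R]_2) :
  (\det A = A 0 0 * A 1 1 - A 0 1 * A 1 0)%R.
Proof.
have lift00 : lift ord0 ord0 = 1%R :> 'I_2 by apply: val_inj.
have lift10 : lift 1%R ord0 = 0%R :> 'I_2 by apply: val_inj.
rewrite (expand_det_row _ ord0) big_ord_recl big_ord1 lift00 /cofactor !det_mx11 !mxE.
by rewrite lift00 lift10 GRing.expr0 GRing.expr1 GRing.mul1r GRing.mulN1r GRing.mulrN.
Qed.

(** The lower and upper unitriangular matrices [A] and [B] have products [A * B] and [B * A] with
    different top left entries. *)
Lemma SL2_2_not_abelian : ~~ abelian SL2_2.
Proof.
pose A : 'M['F_2]_2 := (\matrix_(i, j) (if (i == 0) && (j == 1) then 0 else 1))%R.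
pose B : 'M['F_2]_2 := (\matrix_(i, j) (if (i == 1) && (j == 0) then 0 else 1))%R.
have detA : (\det A = 1)%R by rewrite det_mx2 !mxE; apply: val_inj.
have detB : (\det B = 1)%R by rewrite det_mx2 !mxE; apply: val_inj.
have uA : A \in unitmx by rewrite unitmxE detA GRing.unitr1.
have uB : B \in unitmx by rewrite unitmxE detB GRing.unitr1.
apply/negP=> /centsP cSL.
have: commute (FinRing.unit _ uA : {'GL_2(2)}) (FinRing.unit _ uB).
  by apply: cSL; rewrite inE /= ?detA ?detB.
move/(congr1 (fun g : {'GL_2(2)} => GLval g 0 0)%R).
by rewrite /= !mulmx2E !mxE => /(congr1 val).
Qed.

(** Running through all entries over $GF(2)$ shows that a matrix of determinant 1 fixing a nonzero
    vector squares to 1; together with [g ^+ 3 = 1] this forces [g = 1]. *)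
Lemma SL2_2_fixed_vector (g : {'GL_2(2)}) (v : 'rV['F_2]_2) :
  g \in SL2_2 -> g ^+ 3 = 1 -> g != 1 -> (v *m GLval g = v)%R -> v = 0%R.
Proof.
rewrite inE det_mx2 => /eqP; set M := GLval g => detM g3 ntg vM.
have: (v 0 0 = 0 /\ v 0 1 = 0 \/ 
   [/\ M 0 0 * M 0 0 + M 0 1 * M 1 0 = 1, M 0 0 * M 0 1 + M 0 1 * M 1 1 = 0,
    M 1 0 * M 0 0 + M 1 1 * M 1 0 = 0 & M 1 0 * M 0 1 + M 1 1 * M 1 1 = 1])%R.
  have := congr1 (fun u : 'rV_2 => u 0 0)%R vM.
  have := congr1 (fun u : 'rV_2 => u 0 1)%R vM.
  rewrite !mulmx2E; move: detM.
  case: (F2P (M 0 0)%R) => ->; case: (F2P (M 0 1)%R) => ->;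
  case: (F2P (M 1 0)%R) => ->; case: (F2P (M 1 1)%R) => -> //;
  case: (F2P (v 0 0)%R) => ->; case: (F2P (v 0 1)%R) => -> // _ _ _;
  by [left | right; split; apply: val_inj].
case=> [[v0 v1] | [e00 e01 e10 e11]].
  by apply/rowP=> j; rewrite mxE; case: (ord2P j) => ->.
have g2 : g ^+ 2 = 1.
  apply: val_inj; apply/matrixP=> i j; rewrite /= mulmx2E mxE.
  by case: (ord2P i) => ->; case: (ord2P j) => ->.
by case/eqP: ntg; rewrite -g3 expgS g2 mulg1.
Qed.

Lemma isog_Z4_pair (gT : finGroupType) (D : {group gT}) x y :
  <[x]> \x <[y]> = D -> #[x] = 4 -> #[y] = 4 -> D \isog [set: 'Z_4 * 'Z_4].
Proof.
have cycle4_isog (z : gT) : #[z] = 4 -> <[z]> \isog [set: 'Z_4].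
  by move=> oz; rewrite isog_sym; have := Zp_isog z; rewrite oz.
move=> defD ox oy.
have -> : [set: 'Z_4 * 'Z_4] = setX [set: 'Z_4] [set: 'Z_4].
  by apply/setP=> u; rewrite !inE.
apply: isog_dprod defD (setX_dprod _ _) _ _.
  by apply: isog_trans (cycle4_isog x ox) _; rewrite isog_setX1.
by apply: isog_trans (cycle4_isog y oy) _; rewrite isog_set1X.
Qed.

(** Since [s] lies outside [Q], its image in $SL_2(2)$ is a nontrivial element of cube 1, and such
    an element fixes only the zero vector. *)
Lemma natural_section_fixed (gT : finGroupType) (G Q U V : {group gT}) s u :
    natural_section G Q U V -> Q <| G -> s \in G -> s ^+ 3 = 1 -> s \notin Q ->
  u \in U -> U \subset 'N(V) -> coset V (u ^ s) = coset V u -> u \in V.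
Proof.
case=> f [h [isoF isoH act_h]] nsQG Gs s3 Q's Uu nVU fix_u.
move: isoF isoH; rewrite SL2_2E => /isomP[injf _] /isomP[injh _].
have nQs : s \in 'N(Q) by apply: subsetP Gs; apply: normal_norm.
have nVu : u \in 'N(V) by apply: subsetP Uu.
have GQs : coset Q s \in G / Q by apply: mem_quotient.
rewrite coset_idr //; apply/eqP; rewrite -(morph_injm_eq1 injh) ?mem_quotient //.
apply/eqP/(@SL2_2_fixed_vector (f (coset Q s))); first by rewrite SL2_2E inE.
- by rewrite -!morphX // s3 morph1 morph1.
- rewrite morph_injm_eq1 //; apply: contra Q's => /eqP; exact: coset_idr.
by rewrite -act_h // fix_u.
Qed.

Lemma natural_section_abelem (gT : finGroupType) (G Q U V : {group gT}) :
  natural_section G Q U V -> 2.-abelem (U / V) /\ #|U / V| = 4.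
Proof.
case=> f [h [_ /isom_isog isoH _]].
have isoUV := isoH (subxx _).
by rewrite (card_isog isoUV) (isog_abelem isoUV) cardsT card_mx card_Fp ?mx_Fp_abelem.
Qed.

(** The complement is nonabelian of order 6, so [<[s]>] has index 2 and is normal. Thus [s ^ t] is a
    power of [s]: it is not 1, and it is not [s] because [L] would then be abelian. *)
Lemma biextraspecial_complement (gT : finGroupType) (G Q L : {group gT}) s t :
    Q ><| L = G -> G / Q \isog SL2_2 -> s \in L -> #[s] = 3 ->
  t \in L -> L :=: <<[set s; t]>> -> s ^ t = s^-1.
Proof.
move=> defG isoGQ Ls os Lt defL; rewrite SL2_2E in isoGQ.
have isoL := isog_trans (sdprod_isog defG) isoGQ.
have oL : #|L| = 6.
  by rewrite (card_isog isoL) card_GL_2 card_Fp.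
have not_cLL : ~~ abelian L.
  by have:= SL2_2_not_abelian; rewrite SL2_2E (isog_abelian isoL).
have nsL : <[s]> <| L.
  apply: index2_normal; rewrite ?cycle_subG //.
  apply/eqP; rewrite -(eqn_pmul2l (cardG_gt0 <[s]>)).
  by rewrite Lagrange ?cycle_subG // oL -orderE os.
have: s ^ t \in <[s]> by rewrite memJ_norm ?cycle_id // (subsetP (normal_norm nsL)).
case/cyclePmin => [[|[|[|//]]]]; rewrite os // => _.
- by move/eqP; rewrite conjg_eq1 -order_eq1 os.
- move/conjg_fixP/commgP => cst; case/negP: not_cLL.
  rewrite defL abelian_gen /abelian; apply/centsP=> x x_st y y_st.
  by case/set2P: x_st => ->; case/set2P: y_st => ->.
move=> ->; apply: (mulgI s).
by rewrite -expgS mulgV -os expg_order.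
Qed.

(** * Setting and notation for a biextraspecial group with its complement *)

Section Dents.

Variables (gT : finGroupType) (m : nat) (G Q L : {group gT}) (s t : gT).
Hypotheses (bG : biextraspecial m G Q) (defG : Q ><| L = G).
Hypotheses (Lt : t \in L) (ot : #[t] = 2) (os : #[s] = 3).
Hypothesis defL : L :=: <<[set s; t]>>.

Local Notation Z := 'Z(Q).
Local Notation R := 'C_Q[t].

Let nsQG : Q <| G. Proof. by case: bG => _ [-> _ _ _]. Qed.

Let sLG : L \subset G. Proof. by case/sdprod_context: defG. Qed.

Let Ls : s \in L. Proof. by rewrite defL mem_gen // !inE eqxx. Qed.

Let nsZG : Z <| G. Proof. exact: gFnormal_trans. Qed.

Let sZQ : Z \subset Q. Proof. exact: center_sub. Qed.

Let s3 : s ^+ 3 = 1. Proof. by rewrite -os expg_order. Qed.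

Let t2 : t ^+ 2 = 1. Proof. by rewrite -ot expg_order. Qed.

Let Q's : s \notin Q.
Proof.
have [_ _ _ _ tiQL] := sdprod_context defG.
apply/negP=> Qs; have: s \in Q :&: L by rewrite inE Qs.
by rewrite tiQL => /set1P s1; move: os; rewrite s1 order1.
Qed.

Let st : s ^ t = s^-1.
Proof.
case: bG => _ [_ _ _ isoGQ] _ _; exact: (biextraspecial_complement defG isoGQ).
Qed.

Let nZG g : g \in G -> g \in 'N(Z). Proof. exact/subsetP/normal_norm. Qed.
Let nZQ x : x \in Q -> x \in 'N(Z).
Proof. by move=> Qx; apply/nZG/(subsetP (normal_sub nsQG)). Qed.
Let nZs : s \in 'N(Z). Proof. exact/nZG/(subsetP sLG). Qed.
Let nZt : t \in 'N(Z). Proof. exact/nZG/(subsetP sLG). Qed.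
Let nQG g : g \in G -> g \in 'N(Q). Proof. exact/subsetP/normal_norm. Qed.
Let nQs : s \in 'N(Q). Proof. exact/nQG/(subsetP sLG). Qed.
Let nQt : t \in 'N(Q). Proof. exact/nQG/(subsetP sLG). Qed.

Let Qs x : x \in Q -> x ^ s \in Q. Proof. by rewrite memJ_norm. Qed.
Let Qt x : x \in Q -> x ^ t \in Q. Proof. by rewrite memJ_norm. Qed.
Let Zs x : x \in Z -> x ^ s \in Z. Proof. by rewrite memJ_norm. Qed.
Let ZQ x : x \in Z -> x \in Q. Proof. exact/subsetP. Qed.

(** * The action of [s] on [Z] and [Q / Z], and commutators in [Q] *)

Lemma center_commute z x : z \in Z -> x \in Q -> commute z x.
Proof. by case/centerP=> _ cz /cz. Qed.

Lemma centerJ z x : z \in Z -> x \in Q -> z ^ x = z.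
Proof. by move=> Zz Qx; apply/conjg_fixP/commgP/center_commute. Qed.

Lemma center_abelem : 2.-abelem Z.
Proof.
case: bG => _ _ /natural_section_abelem[+ _] _.
by rewrite (isog_abelem (quotient1_isog 'Z(Q))).
Qed.

Lemma card_center : #|Z| = 4.
Proof.
case: bG => _ _ /natural_section_abelem[_ <-] _.
by rewrite (card_isog (quotient1_isog 'Z(Q))).
Qed.

Lemma center_fpf z : z \in Z -> z ^ s = z -> z = 1.
Proof.
case: bG => _ _ natZ _ Zz zs; apply/set1P.
apply: (natural_section_fixed natZ nsQG (subsetP sLG s Ls) s3 Q's Zz); rewrite ?zs //.
by rewrite norms1.
Qed.

(** Descent along a chief series: if [x] lies in a normal subgroup [N] strictly above [Z], choose
    [V] maximal among the proper [G]-invariant subgroups of [N] above [Z]. Then [N / V] is a chief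
    factor, hence natural, and [x] is fixed by [s] modulo [V], so [x] already lies in [V]. *)
Lemma fpf_mod_center x : x \in Q -> [~ x, s] \in Z -> x \in Z.
Proof.
move=> Qx Zxs; suffices IH n (N : {group gT}) : #|N| < n ->
    N \subset Q -> N <| G -> Z \subset N -> x \in N -> x \in Z.
  exact: (IH _ Q (leqnn _)).
elim: n => // n IHn in N *; rewrite ltnS => leNn sNQ nsNG sZN Nx.
have [eqZN | neqZN] := eqVneq (Z : {set gT}) N; first by rewrite eqZN.
(* This makes [Z] itself a candidate, from which a maximal [V] above [Z] is obtained. *)
have: (Z \proper N) && (G \subset 'N(Z)) by rewrite properEneq neqZN sZN normal_norm.
pose gV (V : {group gT}) := (V \proper N) && (G \subset 'N(V)).
case/(@maxgroup_exists _ gV 'Z(Q)%G)=> V maxV sZV.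
have [/andP[/andP[sVN nsVN] nVG] _] := maxgroupP maxV.
have nsVG : V <| G by rewrite /normal nVG (subset_trans sVN) ?normal_sub.
have Vx: x \in V.
  case: bG => _ _ _ [_ _ /(_ N V sZV sNQ)] natN.
  apply: (natural_section_fixed (natN _) nsQG (subsetP sLG s Ls) s3 Q's Nx).
  - by rewrite /chief_factor nsNG andbT.
  - exact: subset_trans (normal_sub nsNG) nVG.
  have -> : x ^ s = x * [~ x, s] by rewrite mulKVg.
  have nVx : x \in 'N(V) by apply: (subsetP nVG); apply: (subsetP (normal_sub nsNG)).
  by rewrite coset_kerr // (subsetP sZV).
apply: (IHn V) => //; last exact: subset_trans sVN sNQ.
by apply: leq_trans leNn; apply: proper_card; rewrite properE sVN.
Qed.

Let abelQZ : 2.-abelem (Q / Z). Proof. by case: bG => _ _ _ []. Qed.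

Lemma quotient_fpf X : X \in Q / Z -> X ^ coset Z s = X -> X = 1.
Proof.
case/morphimP=> x nZx Qx -> /= Xs; apply: coset_id; apply: fpf_mod_center => //.
rewrite coset_idr ?groupR // morphR //.
by apply/eqP/conjg_fixP.
Qed.

Let coset_eqN x y : x \in 'N(Z) -> y \in 'N(Z) -> coset Z x = coset Z y ->
  exists2 z, z \in Z & y = x * z.
Proof.
move=> nZx nZy eqxy; have nZxV := groupVr nZx.
exists (x^-1 * y); last by rewrite mulKVg.
apply: coset_idr; first exact: groupM.
by rewrite morphM // morphV //= eqxy mulVg.
Qed.

Let coset_eqE x y : x \in Q -> coset Z x = coset Z y -> y \in Q ->
  exists2 z, z \in Z & y = x * z.
Proof. by move=> Qx eqxy Qy; apply: coset_eqN eqxy; apply: nZQ. Qed.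

Let cosetM x y : x \in Q -> y \in Q -> coset Z (x * y) = coset Z x * coset Z y.
Proof. by move=> Qx Qy; rewrite morphM ?nZQ. Qed.

Let cosetJs x : x \in Q -> coset Z (x ^ s) = coset Z x ^ coset Z s.
Proof. by move=> Qx; rewrite morphJ ?(nZQ Qx). Qed.

Let cosetJt x : x \in Q -> coset Z (x ^ t) = coset Z x ^ coset Z t.
Proof. by move=> Qx; rewrite morphJ ?(nZQ Qx). Qed.

Let bs3 : coset Z s ^+ 3 = 1. Proof. by rewrite -morphX // s3 morph1. Qed.
Let bt2 : coset Z t ^+ 2 = 1. Proof. by rewrite -morphX // t2 morph1. Qed.
Let bst : coset Z s ^ coset Z t = (coset Z s)^-1.
Proof. by rewrite -morphJ // st morphV. Qed.
Let bnQs : coset Z s \in 'N(Q / Z).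
Proof. by apply: (subsetP (quotient_norm _ _)); apply: mem_quotient. Qed.
Let bnQt : coset Z t \in 'N(Q / Z).
Proof. by apply: (subsetP (quotient_norm _ _)); apply: mem_quotient. Qed.

Let mem_quoQ x : x \in Q -> coset Z x \in Q / Z. Proof. exact: mem_quotient. Qed.

Let ZZ1 z : z \in Z -> z * z = 1. Proof. exact: (abelem2_sq center_abelem). Qed.

Let ZV z : z \in Z -> z^-1 = z.
Proof. by move=> Zz; apply: (mulgI z); rewrite mulgV ZZ1. Qed.

Lemma commg_center x y : x \in Q -> y \in Q -> [~ x, y] \in Z.
Proof.
move=> Qx Qy; have /and3P[_ cQZ _] := abelQZ.
rewrite coset_idr ?groupR ?nZQ // morphR ?nZQ //.
by apply/eqP/commgP/(centsP cQZ); apply: mem_quoQ.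
Qed.

Lemma sq_center x : x \in Q -> x * x \in Z.
Proof.
move=> Qx; rewrite coset_idr ?groupM ?nZQ // morphM ?nZQ //.
exact: (abelem2_sq abelQZ (mem_quoQ Qx)).
Qed.

Lemma commMl x y z : x \in Q -> y \in Q -> z \in Q ->
  [~ x * y, z] = [~ x, z] * [~ y, z].
Proof. by move=> Qx Qy Qz; rewrite commMgJ centerJ ?commg_center. Qed.

Lemma commMr x y z : x \in Q -> y \in Q -> z \in Q ->
  [~ x, y * z] = [~ x, y] * [~ x, z].
Proof.
move=> Qx Qy Qz; rewrite commgMJ centerJ ?commg_center //.
exact: center_commute (commg_center Qx Qz) (groupR Qx Qy).
Qed.

Lemma commVr x y : x \in Q -> y \in Q -> [~ x, y^-1] = [~ x, y].
Proof.
move=> Qx Qy; have Zc := commg_center Qx Qy.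
rewrite -[RHS]ZV //; apply: (mulgI [~ x, y]); rewrite mulgV.
by rewrite -commMr ?groupV // mulgV commg1.
Qed.

Lemma commC x y : x \in Q -> y \in Q -> [~ x, y] = [~ y, x].
Proof. by move=> Qx Qy; rewrite -invg_comm ZV ?commg_center. Qed.

Lemma commZr x z : x \in Q -> z \in Z -> [~ x, z] = 1.
Proof. by move=> Qx Zz; apply/eqP/commgP/commute_sym/center_commute. Qed.

(** Modulo [Z], the element [w] is [x * y]. Hence $[x,y]^s=[y,w]=[y,x]=[x,y]$ is a central element
    fixed by [s], so it is trivial. Likewise [x * y * w] is central, and [s] sends it to
    [y * w * x], its conjugate by [x], which is the element itself. *)
Lemma conj_sss_mul1 x : x \in Q -> commute x (x ^ s) /\ x * x ^ s * (x ^ s) ^ s = 1.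
Proof.
move=> Qx; set y := x ^ s; set w := y ^ s.
have Qy : y \in Q := Qs Qx; have Qw : w \in Q := Qs Qy; have Qxy := groupM Qx Qy.
have [z Zz def_w] : exists2 z, z \in Z & w = x * y * z.
  apply: coset_eqE => //; rewrite morphM ?nZQ // /w cosetJs //= /y cosetJs //.
  by rewrite (conj_ss abelQZ bnQs bs3 quotient_fpf (mem_quoQ Qx)).
have cxy : commute x y.
  apply/commgP/eqP/center_fpf; first exact: commg_center.
  rewrite conjRg -/y -/w def_w (commMr Qy Qxy (ZQ Zz)) (commZr Qy Zz) mulg1.
  by rewrite (commMr Qy Qx Qy) commgg mulg1 commC.
split=> //; have ZP : x * y * w \in Z.
  by rewrite def_w mulgA groupM // sq_center.
have sssx : w ^ s = x by apply: conj_sss.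
apply: center_fpf => //; rewrite 2!conjMg -/y -/w sssx.
by rewrite -[RHS](centerJ ZP Qx) /conjg -!mulgA mulKg.
Qed.

Lemma center_generator : exists a, [/\ a \in Z, a ^ t = a & a != 1].
Proof.
apply: (exists_fixed center_abelem nZs nZt s3 t2 st center_fpf (subxx _) nZs nZt).
by rewrite trivg_card1 card_center.
Qed.

Lemma center_natmod a : a \in Z -> a != 1 -> Z = natmod s a.
Proof.
move=> Za nta; apply/esym/eqP; rewrite eqEcard card_center.
rewrite (natmod_sub center_abelem nZs Za).
by rewrite (card_natmod center_abelem nZs s3 center_fpf Za nta).
Qed.

Lemma center_fixed a z : a \in Z -> a ^ t = a -> a != 1 -> z \in Z -> z ^ t = z ->
  z != 1 -> z = a.
Proof.
move=> Za at_ nta Zz; apply: (natmod_fixed center_abelem nZs s3 st center_fpf Za at_).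
by rewrite -center_natmod.
Qed.

(** * The centralizer [R] of [t] in [Q] and its centre *)

Lemma centQtP x : reflect (x \in Q /\ x ^ t = x) (x \in R).
Proof.
rewrite inE (sameP cent1P commgP) (sameP conjg_fixP eqP).
by apply: (iffP andP) => -[-> /eqP].
Qed.

(** The obstruction to lifting is the element [z] with [x ^ t = x * z]. It is itself fixed by [t],
    and every [t]-fixed element of [Z] is a product [z ^ s * (z ^ s) ^ t], so replacing [x] by
    [x * z ^ s] removes it. *)
Lemma centQt_lift x : x \in Q -> coset Z (x ^ t) = coset Z x ->
  exists2 r, r \in R & coset Z r = coset Z x.
Proof.
move=> Qx fix_x; have [z Zz def_xt] := coset_eqE Qx (esym fix_x) (Qt Qx).
have [z1 | ntz] := eqVneq z 1.
  by exists x => //; apply/centQtP; rewrite def_xt z1 mulg1.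
(* Applying [t] twice to [x] gives [z * z ^ t = 1], and [z] is its own inverse. *)
have zt : z ^ t = z.
  apply: (mulgI (x * z)); rewrite -{1}def_xt -conjMg -def_xt conj_tt //.
  by rewrite def_xt -mulgA ZZ1 ?mulg1.
have Zzs := Zs Zz; exists (x * z ^ s); last by rewrite coset_kerr.
apply/centQtP; split; first exact: groupM Qx (ZQ Zzs).
rewrite conjMg def_xt (conj_fixed_st center_abelem nZs s3 st center_fpf Zz zt).
by rewrite mulgA -(mulgA x) ZZ1 ?mulg1.
Qed.

(** This is [fixed_decomposition] in [Q / Z] with both [t]-fixed factors lifted to [R]: [r1] comes
    from [(q ^ s) ^ s] and [r2] from [q]. It reduces centrality in [Q] to commutation with [R] and
    its [s]-conjugates. *)
Lemma centQt_generate q : q \in Q -> exists r1 r2 z,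
  [/\ r1 \in R, r2 \in R, z \in Z & q = r1 * r2 ^ s * z].
Proof.
move=> Qq; have Qqss := Qs (Qs Qq).
have lift y : y \in Q -> exists2 r, r \in R & coset Z r = coset Z (y * y ^ t).
  move=> Qy; have Qyt := Qt Qy; apply: centQt_lift; first exact: groupM.
  rewrite conjMg conj_tt // (cosetM Qyt Qy) (cosetM Qy Qyt).
  exact: (abelem2_commute abelQZ (mem_quoQ Qyt) (mem_quoQ Qy)).
have [[r1 Rr1 e1] [r2 Rr2 e2]] := (lift _ Qqss, lift _ Qq).
have [[Qr1 _] [Qr2 _]] := (centQtP _ Rr1, centQtP _ Rr2).
exists r1, r2; have [|||z Zz def_q] := @coset_eqE (r1 * r2 ^ s) q.
- exact: groupM Qr1 (Qs Qr2).
- rewrite (cosetM Qr1 (Qs Qr2)) cosetJs // e1 e2 (cosetM Qqss (Qt Qqss)).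
  rewrite (cosetM Qq (Qt Qq)) !cosetJt // cosetJs ?Qs // cosetJs //.
  rewrite -(fixed_decomposition abelQZ bnQs bnQt bs3 bst quotient_fpf (mem_quoQ Qq)) //.
- by [].
by exists z.
Qed.

(* The commutator map is L-equivariant and bilinear, and it vanishes on (x, y),
   (x^s, y^s) and (x x^s, y y^s). *)
Lemma centQt_commuteJs x y : x \in R -> y \in R -> commute x y -> commute x (y ^ s).
Proof.
move=> /centQtP[Qx xt] /centQtP[Qy yt] cxy.
have [[Qxs Qys] [Qxss Qyss]] := ((Qs Qx, Qs Qy), (Qs (Qs Qx), Qs (Qs Qy))).
have [[_ tr_x] [_ tr_y]] := (conj_sss_mul1 Qx, conj_sss_mul1 Qy).
have commJ u v : commute u v -> [~ u ^ s, v ^ s] = 1.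
  by move=> cuv; rewrite -conjRg (eqP (introT commgP cuv)) conj1g.
have ssE u : u * u ^ s * (u ^ s) ^ s = 1 -> (u ^ s) ^ s = (u * u ^ s)^-1.
  by move=> tr_u; apply: (mulgI (u * u ^ s)); rewrite tr_u mulgV.
have [Qxx Qyy] := (groupM Qx Qxs, groupM Qy Qys); have QxV := groupVr Qxx.
have cxys := commg_center Qx Qys.
(* Expanding $[xx^s,yy^s]=1$ leaves only the two mixed commutators, which must therefore agree. *)
have e : [~ x ^ s, y] = [~ x, y ^ s].
  have: [~ (x ^ s) ^ s, (y ^ s) ^ s] = 1.
    by rewrite -!conjRg (eqP (introT commgP cxy)) !conj1g.
  rewrite (ssE x) // (ssE y) // (commVr QxV Qyy) (commC QxV Qyy) (commVr Qyy Qxx).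
  rewrite (commMl Qy Qys Qxx) (commMr Qy Qx Qxs) (commMr Qys Qx Qxs) (commC Qy Qx).
  rewrite (eqP (introT commgP cxy)) mul1g (commJ y x) ?mulg1 => [e1|]; last first.
    exact: commute_sym.
  apply: (mulIg [~ x, y ^ s]).
  by rewrite (ZZ1 cxys) (commC Qxs Qy) (commC Qx Qys).
(* Conjugation by [s] turns $[x,y^s]$ into $[x^s,yy^s]=[x^s,y]$, which equals $[x,y^s]$ by [e]. *)
apply/commgP/eqP/center_fpf => //.
have cxys2 : [~ x ^ s, y ^ s] = 1 by apply: commJ.
by rewrite conjRg (ssE y) // (commVr Qxs Qyy) (commMr Qxs Qy Qys) cxys2 mulg1.
Qed.

(** An element of [R] that centralizes [R] also centralizes the [s]-conjugates of [R] by
    [centQt_commuteJs], and these together with [R] and [Z] generate [Q]. *)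
Lemma centQt_center x : (x \in 'Z(R)) = (x \in Z) && (x ^ t == x).
Proof.
apply/idP/andP=> [/centerP[/centQtP[Qx xt] cRx] | [Zx /eqP xt]]; last first.
  have Rx : x \in R by apply/centQtP; rewrite ZQ.
  by apply/centerP; split=> // y /centQtP[Qy _]; apply: center_commute.
split; last exact/eqP.
apply/centerP; split=> // _ /centQt_generate[r1 [r2 [z [Rr1 Rr2 Zz ->]]]].
have Rx : x \in R by apply/centQtP.
apply: commuteM; last by apply: commute_sym; apply: center_commute.
by apply: commuteM; [apply: cRx | apply: centQt_commuteJs; last apply: cRx].
Qed.

(** The centre of [R] is the set of [t]-fixed points of the natural module [Z]. *)
Lemma card_centQt_center : #|'Z(R)| = 2.
Proof.
have [a [Za at_ nta]] := center_generator.
have -> : 'Z(R) = [set 1; a].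
  apply/setP=> x; rewrite centQt_center in_set2; apply/andP/pred2P.
    case=> Zx /eqP xt; have [-> | ntx] := eqVneq x 1; first by left.
    by right; apply: center_fixed ntx.
  by case=> ->; rewrite ?group1 ?conj1g ?at_ ?Za.
by rewrite cards2 eq_sym nta.
Qed.

(** * Dents as the subgroups generated by [x], [x ^ s] and [Z] with [x] in [R] *)

Let nZL l : l \in L -> l \in 'N(Z). Proof. by move=> Ll; apply/nZG/(subsetP sLG). Qed.

(** It translates the quotient action used in the definition of a dent into the normalizer
    conditions of the natural module lemmas. *)
Lemma acts_complement (B : {group coset_of Z}) :
  [acts L, on B | 'J / Z] = (coset Z s \in 'N(B)) && (coset Z t \in 'N(B)).
Proof.
have act1 l : l \in L -> (l \in 'N(B | 'J / Z)) = (coset Z l \in 'N(B)).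
  move=> Ll; have nZl := nZL Ll.
  apply/idP/idP=> [nBl | nBl].
    rewrite inE; apply/subsetP=> _ /imsetP[X BX ->].
    by have := astabs_act X nBl; rewrite qactJ nZl BX.
  apply/setIP; split; first by rewrite dom_qactJ.
  rewrite inE; apply/subsetP=> X BX.
  by rewrite inE /= qactJ nZl memJ_norm.
by rewrite {1}defL gen_subG subUset !sub1set !act1.
Qed.

(** As a preimage it contains [Z] and has quotient [natmod] whatever [x] is; the generators appear
    in [dent_of_gen]. *)
Definition dent_of x : {group gT} :=
  (coset Z @*^-1 natmod (coset Z s) (coset Z x))%G.

Lemma coset_coords x p : x \in Q ->
  coset Z (coords s x p) = coords (coset Z s) (coset Z x) p.
Proof.
move=> Qx; rewrite /coords cosetM ?groupX ?Qs // !morphX ?nZQ ?Qs //=.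
by rewrite cosetJs.
Qed.

Lemma coords_in x p : x \in Q -> coords s x p \in Q.
Proof. by move=> Qx; rewrite groupM ?groupX ?Qs. Qed.

Lemma dent_ofP x d : x \in Q ->
  reflect (exists p z, z \in Z /\ d = coords s x p * z) (d \in dent_of x).
Proof.
move=> Qx; have Qp p := coords_in p Qx; have QX := mem_quoQ Qx.
apply: (iffP morphpreP) => [[nZd] | [p [z [Zz ->]]]].
  case/(natmodP abelQZ bnQs _ QX)=> p def_d.
  have [|z Zz ->] := coset_eqN (nZQ (Qp p)) nZd; first by rewrite coset_coords.
  by exists p, z.
split; first exact: groupM (nZQ (Qp p)) (nZQ (ZQ Zz)).
rewrite /= coset_kerr // coset_coords //.
by apply/(natmodP abelQZ bnQs) => //; exists p.
Qed.

Lemma mem_dent_of x : x \in Q -> x \in dent_of x.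
Proof.
move=> Qx; apply/dent_ofP=> //; exists (true, false), 1.
by rewrite group1 /coords !mulg1.
Qed.

Lemma dent_of_quotient x : dent_of x / Z = natmod (coset Z s) (coset Z x).
Proof. exact: cosetpreK. Qed.

Lemma center_sub_dent_of x : Z \subset dent_of x.
Proof. exact: sub_cosetpre. Qed.

Lemma dent_of_sub x : x \in Q -> dent_of x \subset Q.
Proof.
move=> Qx; apply/subsetP=> _ /dent_ofP[] // p [z [Zz ->]].
exact: groupM (coords_in p Qx) (ZQ Zz).
Qed.

Lemma dent_of_gen x : x \in Q -> dent_of x = <<[set x; x ^ s] :|: Z>> :> {set gT}.
Proof.
move=> Qx; apply/eqP; rewrite eqEsubset; apply/andP; split.
  apply/subsetP=> _ /dent_ofP[] // p [z [Zz ->]].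
  apply: groupM; last by rewrite mem_gen // inE Zz orbT.
  by apply: groupM; apply: groupX; rewrite mem_gen // !inE eqxx ?orbT.
rewrite gen_subG !subUset !sub1set mem_dent_of // center_sub_dent_of andbT /=.
apply/dent_ofP=> //; exists (false, true), 1.
by rewrite group1 /coords mulg1 mul1g.
Qed.

Lemma dent_of_abelian x : x \in Q -> abelian (dent_of x).
Proof.
move=> Qx; have [cxy _] := conj_sss_mul1 Qx; have Qxs := Qs Qx.
rewrite dent_of_gen // abelian_gen abelianE; apply/centsP.
have cZ z y : z \in Z -> y \in Q -> commute y z.
  by move=> Zz Qy; apply/commute_sym/center_commute.
have Ugen u : u \in [set x; x ^ s] :|: Z -> [\/ u = x, u = x ^ s | u \in Z].
  by case/setUP=> [/set2P[]|]; [constructor 1 | constructor 2 | constructor 3].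
move=> u /Ugen[->|->|Zu] v /Ugen[->|->|Zv] //; try exact: cZ; try exact: commute_sym;
 try (by apply/commute_sym/cZ); exact: (cZ _ _ Zv (ZQ Zu)).
Qed.

Section FixedPoint.

Variable x : gT.
Hypotheses (Rx : x \in R) (notZx : x \notin Z).

Let Qx : x \in Q. Proof. by case/centQtP: Rx. Qed.
Let xt : x ^ t = x. Proof. by case/centQtP: Rx. Qed.
Let QX : coset Z x \in Q / Z. Proof. exact: mem_quoQ. Qed.
Let Xt : coset Z x ^ coset Z t = coset Z x.
Proof. by rewrite -cosetJt // xt. Qed.
Let ntX : coset Z x != 1.
Proof. by apply: contra notZx => /eqP; apply: coset_idr; apply: nZQ. Qed.

Lemma card_dent_of : #|dent_of x| = 16.
Proof.
by rewrite card_cosetpre card_center (card_natmod abelQZ bnQs bs3 quotient_fpf QX ntX).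
Qed.

(** [Q] acts trivially on the abelian group [Q / Z], while [s] and [t] normalize the natural module
    spanned by the image of [x]; these generate [G]. *)
Lemma dent_of_norm g : g \in G -> g \in 'N(dent_of x).
Proof.
have sDQ := dent_of_sub Qx.
have normJ h : h \in 'N(Z) -> coset Z h \in 'N(natmod (coset Z s) (coset Z x)) ->
    h \in 'N(dent_of x).
  move=> nZh nXh; rewrite inE; apply/subsetP=> _ /imsetP[d Dd ->].
  have nZd := nZQ (subsetP sDQ d Dd).
  apply/morphpreP; rewrite groupJ //; split=> //; rewrite /= morphJ // memJ_norm //.
  by case/morphpreP: Dd.
have sQN : Q \subset 'N(dent_of x).
  apply/subsetP=> q Qq; apply: normJ; first exact: nZQ.
  apply: (subsetP (cent_sub _)); apply: (subsetP (centS (natmod_sub abelQZ bnQs QX))).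
  by have /and3P[_ /subsetP cQZ _] := abelQZ; apply/cQZ/mem_quoQ.
have sLN : L \subset 'N(dent_of x).
  rewrite defL gen_subG subUset !sub1set !normJ //.
    exact: natmod_normt abelQZ bnQs bs3 bst quotient_fpf _ QX Xt.
  exact: natmod_norms abelQZ bnQs bs3 quotient_fpf _ QX.
by apply: subsetP; rewrite -(sdprodW defG) mul_subG.
Qed.

Lemma dent_of_fixed y : y \in R -> y \notin Z -> y \in dent_of x ->
  coset Z x = coset Z y.
Proof.
case/centQtP=> Qy yt notZy /morphpreP[_ Dy].
apply/esym; apply: (natmod_fixed abelQZ bnQs bs3 bst quotient_fpf QX Xt Dy).
  by rewrite -cosetJt // yt.
by apply: contra notZy => /eqP; apply: coset_idr; apply: nZQ.
Qed.

(** The group is abelian of order 16, so only its exponent matters; it is generated by [x], a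
    conjugate of [x], and [Z], which has exponent 2. *)
Lemma singular_dent_of : singular (dent_of x) = (x ^+ 2 == 1).
Proof.
have cDD := dent_of_abelian Qx.
rewrite /singular isog_sym (isog_abelem_card _ (mx_Fp_abelem 1 4 (isT : prime 2))).
rewrite card_dent_of cardsT card_mx card_Fp // eqxx andbT abelemE // cDD /=.
apply/exponentP/eqP => [-> //|]; first exact: mem_dent_of.
move=> x2 _ /dent_ofP[] // p [z [Zz ->]]; have [cxxs _] := conj_sss_mul1 Qx.
have sq_bit (u : gT) (i : bool) : u ^+ 2 = 1 -> (u ^+ i) ^+ 2 = 1.
  by case: i => // _; apply: expg1n.
rewrite expgMn; last by apply/commute_sym/center_commute; rewrite ?coords_in.
rewrite expgMn; last by apply/commuteX/commute_sym/commuteX/commute_sym.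
by rewrite !sq_bit ?mul1g -?conjXg ?x2 ?conj1g // expgS ZZ1.
Qed.

(** The squares of [x] and [x ^ s] generate [Z], so these two elements of order 4 generate the whole
    group. As its order is 16, the two cyclic subgroups meet trivially. *)
Lemma nonsingular_dent_of : x ^+ 2 != 1 -> nonsingular (dent_of x).
Proof.
move=> ntx2; have Zx2 : x ^+ 2 \in Z by apply: sq_center.
have [cxxs _] := conj_sss_mul1 Qx; set y := x ^ s in cxxs.
have ox : #[x] = 4.
  have: #[x] %| 2 ^ 2 by rewrite order_dvdn (expgM x 2 2) expgS ZZ1.
  case/(dvdn_pfactor _ _ (isT : prime 2)) => -[|[|[|//]]] // _ ox;
    by case/negP: ntx2; rewrite -order_dvdn ox.
have oy : #[y] = 4 by rewrite orderJ.
have cXY : <[y]> \subset 'C(<[x]>).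
  by apply: cents_cycle; apply: commute_sym.
have defD : <[x]> * <[y]> = dent_of x.
  apply/eqP; rewrite eqEsubset -cent_joinEr //; apply/andP; split.
    rewrite join_subG !cycle_subG mem_dent_of //= /y memJ_norm ?mem_dent_of //.
    exact/dent_of_norm/(subsetP sLG).
  rewrite dent_of_gen // gen_subG !subUset !sub1set (center_natmod Zx2 ntx2).
  have jx : x \in <[x]> <*> <[y]> by rewrite mem_gen // inE cycle_id.
  have jy : y \in <[x]> <*> <[y]> by rewrite mem_gen // inE cycle_id orbT.
  by rewrite jx jy gen_subG subUset !sub1set conjXg !groupX.
apply: (@isog_Z4_pair _ _ x y) => //; rewrite -defD dprodE //.
apply/eqP; rewrite trivg_card1 -(eqn_pmul2l (cardG_gt0 (dent_of x))).
by rewrite -defD -mul_cardG -!orderE ox oy defD card_dent_of.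
Qed.

Lemma is_dent_dent_of : is_dent G Q L (dent_of x).
Proof.
have sDQ := dent_of_sub Qx; have Dx := mem_dent_of Qx.
have sZD := center_sub_dent_of x.
have nsDG : dent_of x <| G.
  apply/andP; split; first exact: subset_trans sDQ (normal_sub nsQG).
  by apply/subsetP=> g; apply: dent_of_norm.
apply/and4P; split=> //.
- by rewrite properE sZD; apply: contra notZx => /subsetP->.
(* If the subgroup were all of [Q], then [Q] would be abelian and [x] central. *)
- rewrite properE sDQ; apply: contra notZx => sQD.
  have cQQ : abelian Q by apply: abelianS sQD (dent_of_abelian Qx).
  by rewrite inE Qx (subsetP cQQ).
have nXs := natmod_norms abelQZ bnQs bs3 quotient_fpf QX.
have nXt := natmod_normt abelQZ bnQs bs3 bst quotient_fpf QX Xt.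
rewrite /acts_irreducibly dent_of_quotient; apply/mingroupP; split.
  rewrite acts_complement nXs nXt !andbT.
  by apply/trivgPn; exists (coset Z x); rewrite ?mem_natmod.
move=> B; rewrite acts_complement => /and3P[ntB nBs nBt] sBX.
exact: natmod_min abelQZ bnQs bnQt bs3 bt2 bst quotient_fpf _ _ QX Xt sBX nBs nBt ntB.
Qed.

End FixedPoint.

(** A nontrivial [t]-fixed vector of [D / Z] lifts to some [x] in [R]; the natural module it spans
    is invariant, so irreducibility makes it all of [D / Z]. *)
Lemma is_dentP D : is_dent G Q L D ->
  exists x, [/\ x \in R, x \notin Z & D = dent_of x].
Proof.
case/and4P=> nsDG /andP[sZD _] /proper_sub sDQ /mingroupP[].
rewrite acts_complement => /and3P[ntB nBs nBt] minB.
have sBQ := quotientS Z sDQ.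
have [X [BX Xt ntX]] :=
  exists_fixed abelQZ bnQs bnQt bs3 bt2 bst quotient_fpf sBQ nBs nBt ntB.
case/morphimP: BX => d nZd Dd /= def_X; rewrite {}def_X in Xt ntX.
have Qd := subsetP sDQ d Dd.
have [|x Rx eqxd] := centQt_lift Qd; first by rewrite cosetJt.
have [Qx xt] := centQtP _ Rx; have QX := mem_quoQ Qx.
have BX : coset Z x \in D / Z by rewrite eqxd mem_quotient.
have Xt' : coset Z x ^ coset Z t = coset Z x by rewrite eqxd.
have ntX' : coset Z x != 1 by rewrite eqxd.
have sXB : natmod (coset Z s) (coset Z x) \subset D / Z.
  by rewrite gen_subG subUset !sub1set BX memJ_norm.
exists x; split=> //; first by apply: contraNN ntX' => Zx; rewrite coset_id.
have eqB : natmod (coset Z s) (coset Z x) = (D / Z)%G.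
  apply/val_inj/minB=> //; rewrite acts_complement.
  rewrite (natmod_norms abelQZ bnQs bs3 quotient_fpf QX).
  rewrite (natmod_normt abelQZ bnQs bs3 bst quotient_fpf QX Xt') !andbT.
  by apply/trivgPn; exists (coset Z x); rewrite ?mem_natmod.
apply/val_inj; rewrite -[RHS]/(coset Z @*^-1 natmod (coset Z s) (coset Z x)).
rewrite eqB quotientGK //.
exact: normalS sZD (normal_sub nsDG) nsZG.
Qed.

(** The quotient of two such elements is a [t]-fixed element of [Z], hence lies in the centre of
    [R]. With [centQt_coset_inj] this embeds $\bar R$ into [Q / Z]. *)
Lemma centQt_coset x y : x \in R -> y \in R -> coset Z x = coset Z y ->
  coset 'Z(R) x = coset 'Z(R) y.
Proof.
move=> /centQtP[Qx xt] /centQtP[Qy yt] eqxy; have [z Zz def_y] := coset_eqE Qx eqxy Qy.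
rewrite def_y coset_kerr // centQt_center Zz.
by apply/eqP/(mulgI x); rewrite -{1}xt -conjMg -def_y.
Qed.

Lemma eq_dent_of x y : coset Z x = coset Z y -> dent_of x = dent_of y.
Proof. by rewrite /dent_of => ->. Qed.

Lemma dent_of_unique D x : is_dent G Q L D -> x \in R -> x \notin Z -> x \in D ->
  D = dent_of x.
Proof.
move=> /is_dentP[y [Ry notZy ->]] Rx notZx Dx.
exact/eq_dent_of/dent_of_fixed.
Qed.

(** The relation $x\,x^s\,x^{s^2}=1$ yields the non-singular formulas directly; in the singular case
    the inverses disappear because [x] squares to 1. *)
Lemma standard_basis_dent_of x : x \in R -> x \notin Z ->
  exists a, standard_basis Q s t (dent_of x) a (a ^ s) x (x ^ s).
Proof.
move=> Rx notZx; have [Qx xt] := centQtP _ Rx.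
have [a [Za at_ nta]] := center_generator; exists a.
have [cxxs tr_x] := conj_sss_mul1 Qx; have sss := conj_sss s3 x.
have xss : (x ^ s) ^ s = x^-1 * (x ^ s)^-1.
  by rewrite -invMg -cxxs; apply: (mulgI (x * x ^ s)); rewrite tr_x mulgV.
have xst : (x ^ s) ^ t = x^-1 * (x ^ s)^-1 by rewrite (conj_st s3 st) xt.
split=> //.
- split=> //; [exact: center_natmod Za nta | exact/eqP].
- split; rewrite ?mem_dent_of ?dent_of_gen //.
  by rewrite mem_gen // !inE eqxx orbT.
rewrite singular_dent_of // => /eqP x2.
have xV : x^-1 = x by apply: (mulgI x); rewrite mulgV -x2.
have xsV : (x ^ s)^-1 = x ^ s by rewrite -conjVg xV.
by rewrite xst xss xsV xV.
Qed.

Lemma standard_basis_fixed D a b x y : is_dent G Q L D ->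
  standard_basis Q s t D a b x y -> [/\ x \in R, x \notin Z & x \in D].
Proof.
move=> dD [_ [Dx _ genD] sing nons]; have [x0 [Rx0 notZx0 defD]] := is_dentP dD.
have [xt xs] : x ^ t = x /\ x ^ s = y.
  (* The square of [x0] tells which of the two conditional clauses of the basis applies; both give
     the same two equations. *)
  have [x2 | x2] := eqVneq (x0 ^+ 2) 1.
    by case: sing; rewrite // defD singular_dent_of ?x2.
  by case: nons; rewrite // defD nonsingular_dent_of.
have [nsDG /andP[sZD notsDZ] /proper_sub sDQ _] := and4P dD.
split=> //; first by apply/centQtP; rewrite (subsetP sDQ).
apply: contra notsDZ => Zx; rewrite genD gen_subG subUset subxx andbT.
by rewrite subUset !sub1set Zx -xs Zs.
Qed.

(** * Isomorphisms between dents and the diagonal dent *)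

Lemma quotient_norm_complement (B : {group coset_of Z}) l :
  coset Z s \in 'N(B) -> coset Z t \in 'N(B) -> l \in L -> coset Z l \in 'N(B).
Proof.
move=> nBs nBt Ll; suff: l \in coset Z @*^-1 'N(B) by case/morphpreP.
apply: subsetP Ll; rewrite defL gen_subG subUset !sub1set.
by apply/andP; split; apply/morphpreP.
Qed.

(** The elements of [L] that commute with [phi] form a subgroup, so it is enough to test [s] and
    [t]. *)
Lemma complement_equivariant (B : {group coset_of Z})
    (phi : coset_of Z -> coset_of Z) l :
    coset Z s \in 'N(B) -> coset Z t \in 'N(B) ->
    {in B, forall u, phi (u ^ coset Z s) = phi u ^ coset Z s} ->
    {in B, forall u, phi (u ^ coset Z t) = phi u ^ coset Z t} ->
  l \in L -> {in B, forall u, phi (u ^ coset Z l) = phi u ^ coset Z l}.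
Proof.
move=> nBs nBt phi_s phi_t Ll.
pose K := [set k in L | [forall u in B, phi (u ^ coset Z k) == phi u ^ coset Z k]].
have gK : group_set K.
  apply/group_setP; split=> [|k1 k2].
    by rewrite inE group1; apply/forall_inP=> u _; rewrite morph1 !conjg1.
  rewrite !inE => /andP[Lk1 /forall_inP phi1] /andP[Lk2 /forall_inP phi2].
  rewrite groupM //; apply/forall_inP=> u Bu.
  rewrite morphM ?nZL // !conjgM -(eqP (phi1 u Bu)); apply: phi2.
  by rewrite memJ_norm // quotient_norm_complement.
have: L \subset Group gK.
  rewrite {1}defL gen_subG subUset !sub1set !inE Ls Lt.
  by apply/andP; split; apply/forall_inP=> u Bu; apply/eqP;
    [apply: phi_s | apply: phi_t].
move/subsetP/(_ l Ll); rewrite inE => /andP[_ /forall_inP phil] u Bu.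
exact/eqP/phil.
Qed.

Lemma mul_notin_center x y : x \in R -> y \in R -> coset Z x != coset Z y ->
  x * y \notin Z.
Proof.
move=> /centQtP[Qx _] /centQtP[Qy _]; apply: contra => Zxy; apply/eqP.
apply: (mulIg (coset Z y)); rewrite -cosetM // coset_id //.
by rewrite (abelem2_sq abelQZ) ?mem_quoQ.
Qed.

(** Equivariance sends the [t]-fixed vector of the source to a nontrivial [t]-fixed vector of the
    target, and there is only one. This is the uniqueness of the $L$-isomorphism. *)
Lemma dent_isoP x y (phi : {ffun coset_of Z -> coset_of Z}) :
    x \in R -> x \notin Z -> y \in R -> y \notin Z ->
    dent_iso L (dent_of x) (dent_of y) phi ->
  forall p, phi (coords (coset Z s) (coset Z x) p) = coords (coset Z s) (coset Z y) p.
Proof.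
move=> Rx notZx Ry notZy /andP[/andP[/morphicP phiM /eqP phi_im] /forall_inP phiL].
have [[Qx xt] [Qy yt]] := (centQtP _ Rx, centQtP _ Ry).
have [QX QY] := (mem_quoQ Qx, mem_quoQ Qy).
rewrite !dent_of_quotient in phiM phi_im phiL.
set X := coset Z x in phiM phi_im phiL QX *; set Y := coset Z y in phi_im QY *.
set S := coset Z s in phiM phi_im phiL *.
have BX : X \in natmod S X by apply: mem_natmod.
have BXs : X ^ S \in natmod S X.
  by rewrite memJ_norm // (natmod_norms abelQZ bnQs bs3 quotient_fpf QX).
have phiJ u l : u \in natmod S X -> l \in L -> phi (u ^ coset Z l) = phi u ^ coset Z l.
  move=> Bu Ll; have /forall_inP/(_ l Ll)/eqP := phiL u Bu.
  by rewrite !qactJ nZL.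
have ntX : X != 1 by apply: contra notZx => /eqP; apply: coset_idr; apply: nZQ.
have phiX : phi X = Y.
  have: phi X \in (natmod S Y)^#.
    by rewrite -phi_im; apply/imsetP; exists X; rewrite // !inE ntX.
  case/setD1P=> nt_phiX B_phiX.
  apply: (natmod_fixed abelQZ bnQs bs3 bst quotient_fpf QY _ B_phiX _ nt_phiX).
    by rewrite -cosetJt // yt.
  by rewrite -phiJ // -cosetJt // xt.
have phi1 : phi 1 = 1.
  by apply: (mulgI (phi 1)); rewrite -phiM ?group1 // !mulg1.
have phiXs : phi (X ^ S) = Y ^ S by rewrite phiJ // phiX.
case=> -[] []; rewrite /coords /= ?expg0 ?expg1 ?mulg1 ?mul1g //.
by rewrite phiM // phiX phiXs.
Qed.

Lemma exists_dent_iso x y : x \in R -> x \notin Z -> y \in R -> y \notin Z ->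
  exists phi : {ffun coset_of Z -> coset_of Z}, dent_iso L (dent_of x) (dent_of y) phi.
Proof.
move=> Rx notZx Ry notZy.
have [[Qx xt] [Qy yt]] := (centQtP _ Rx, centQtP _ Ry).
have [QX QY] := (mem_quoQ Qx, mem_quoQ Qy).
have nt1 u : u \in Q -> u \notin Z -> coset Z u != 1.
  by move=> Qu; apply: contra => /eqP; apply: coset_idr; apply: nZQ.
have fixT u : u \in Q -> u ^ t = u -> coset Z u ^ coset Z t = coset Z u.
  by move=> Qu ut; rewrite -cosetJt ?ut.
have [phi [iso_phi phi_s phi_t _]] := natmod_isom abelQZ bnQs bs3 bst quotient_fpf
  QX (fixT x Qx xt) (nt1 x Qx notZx) QY (fixT y Qy yt) (nt1 y Qy notZy).
exists phi; rewrite /dent_iso !dent_of_quotient iso_phi /=.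
apply/forall_inP=> u Bu; apply/forall_inP=> l Ll; rewrite !qactJ nZL //.
apply/eqP; apply: complement_equivariant phi_s phi_t Ll u Bu.
  exact: natmod_norms abelQZ bnQs bs3 quotient_fpf _ QX.
exact: natmod_normt abelQZ bnQs bs3 bst quotient_fpf _ QX (fixT x Qx xt).
Qed.

(** The isomorphism preserves coordinates, so [u * phi u] has the coordinates of [u] relative to the
    image of [x * y]. The diagonal set is thus already a subgroup. *)
Lemma diagonal_dent_of x y : x \in R -> x \notin Z -> y \in R -> y \notin Z ->
  diagonal Q L (dent_of x) (dent_of y) = dent_of (x * y).
Proof.
move=> Rx notZx Ry notZy.
have [[Qx xt] [Qy yt]] := (centQtP _ Rx, centQtP _ Ry); have Qxy := groupM Qx Qy.
have [QX QY] := (mem_quoQ Qx, mem_quoQ Qy).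
have coordsMul p : coords (coset Z s) (coset Z (x * y)) p =
    coords (coset Z s) (coset Z x) p * coords (coset Z s) (coset Z y) p.
  by rewrite cosetM // (coords_mul abelQZ bnQs).
apply/val_inj; rewrite /= -[RHS]genGid; congr <<_>>.
apply/setP=> z; rewrite inE; apply/andP/idP.
  case=> Qz /existsP[phi /andP[iso_phi /imsetP[u]]].
  rewrite dent_of_quotient => /(natmodP abelQZ bnQs _ QX)[p ->].
  rewrite (dent_isoP Rx notZx Ry notZy iso_phi) -coordsMul => def_z.
  apply/morphpreP; split; first exact: nZQ.
  by apply/(natmodP abelQZ bnQs); [apply: mem_quoQ | exists p].
move=> Dz; have Qz := subsetP (dent_of_sub Qxy) z Dz; split=> //.
have [phi iso_phi] := exists_dent_iso Rx notZx Ry notZy.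
apply/existsP; exists phi; rewrite iso_phi /=; apply/imsetP.
have [_ /(natmodP abelQZ bnQs _ (mem_quoQ Qxy))[p def_z]] := morphpreP Dz.
exists (coords (coset Z s) (coset Z x) p).
  by rewrite dent_of_quotient; apply/(natmodP abelQZ bnQs _ QX); exists p.
by rewrite (dent_isoP Rx notZx Ry notZy iso_phi) -coordsMul.
Qed.

(** * The isometry from the dent space to $\bar R$ *)

Local Notation ZR := 'Z('C_Q[t]%G).

Let nZR x : x \in R -> x \in 'N(ZR).
Proof. exact/subsetP/normal_norm/center_normal. Qed.

Lemma centQt_coset_inj x y : x \in R -> y \in R -> coset ZR x = coset ZR y ->
  coset Z x = coset Z y.
Proof.
move=> Rx Ry eqxy; have [[Qx _] [Qy _]] := (centQtP _ Rx, centQtP _ Ry).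
have RxV := groupVr Rx; have: x^-1 * y \in ZR.
  apply: coset_idr; first exact: nZR (groupM RxV Ry).
  rewrite (morphM _ (nZR RxV) (nZR Ry)) (morphV _ (nZR Rx)) /=.
  by rewrite eqxy mulVg.
rewrite centQt_center => /andP[Zxy _].
by rewrite -(mulKVg x y) coset_kerr.
Qed.

(** The choice is arbitrary, but for a dent all candidates agree modulo the centre of [R], and the
    default 1 is never reached. *)
Definition dent_elt (D : {set gT}) := odflt 1 [pick x in (R :&: D) :\: Z].

Lemma dent_eltP D : is_dent G Q L D ->
  [/\ dent_elt D \in R, dent_elt D \notin Z & D = dent_of (dent_elt D)].
Proof.
move=> dD; rewrite /dent_elt; case: pickP => [x | no_x] /=.
  case/setDP=> /setIP[Rx Dx] notZx; split=> //; exact: dent_of_unique.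
have [x [Rx notZx defD]] := is_dentP dD; have [Qx _] := centQtP _ Rx.
by have /setDP[] := no_x x; split; rewrite // inE Rx defD mem_dent_of.
Qed.

Definition dent_map (d : dent_space G Q L) : coset_of ZR :=
  if d is Some D then coset ZR (dent_elt (val D)) else 1.

Lemma dent_map_dent_of x (D : dent G Q L) : x \in R -> x \notin Z ->
  val D = dent_of x -> dent_map (Some D) = coset ZR x.
Proof.
move=> Rx notZx defD; have [Ry notZy defD'] := dent_eltP (valP D).
have [Qx _] := centQtP _ Rx; apply: centQt_coset => //.
by apply: dent_of_fixed; rewrite // -defD' defD mem_dent_of.
Qed.

Lemma dent_mapP (D : dent G Q L) (v : coset_of ZR) :
  dent_map (Some D) = v <->
  exists a b x y, standard_basis Q s t (val D) a b x y /\ v = coset ZR x.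
Proof.
have dD := valP D; split=> [<- | [a [b [x [y [sb ->]]]]]].
  have [Rx notZx defD] := dent_eltP dD; set x := dent_elt _ in Rx notZx defD *.
  have [a sb] := standard_basis_dent_of Rx notZx.
  by exists a, (a ^ s), x, (x ^ s); rewrite {1}defD.
have [Rx notZx Dx] := standard_basis_fixed dD sb.
by apply: dent_map_dent_of => //; apply: dent_of_unique.
Qed.

Lemma coset_centQt_neq1 x : x \in R -> x \notin Z -> coset ZR x != 1.
Proof.
move=> Rx; apply: contra => /eqP/(coset_idr (nZR Rx)).
by rewrite centQt_center => /andP[].
Qed.

Lemma dent_map_inj : injective dent_map.
Proof.
case=> [D1|] [D2|] //= eq_f; first last.
- have [Rx notZx _] := dent_eltP (valP D2).
  by case/eqP: (coset_centQt_neq1 Rx notZx).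
- have [Rx notZx _] := dent_eltP (valP D1).
  by case/eqP: (coset_centQt_neq1 Rx notZx).
have [Rx _ defD1] := dent_eltP (valP D1); have [Ry _ defD2] := dent_eltP (valP D2).
congr Some; apply: val_inj; rewrite /= defD1 defD2.
exact/eq_dent_of/centQt_coset_inj.
Qed.

(** An element of [R] outside [Z] is reached from its own [dent_of]; one inside [Z] is central in
    [R] and is the image of the formal zero. *)
Lemma dent_map_im : [set dent_map d | d in [set: dent_space G Q L]] = 'C_Q[t]%G / ZR.
Proof.
apply/setP=> v; apply/imsetP/idP=> [[[D|] _ ->] /= | ]; last 2 first.
- exact: group1.
- case/morphimP=> x _ Rx ->; have [Zx | notZx] := boolP (x \in Z).
    exists None; first by rewrite inE.
    rewrite /= coset_id // centQt_center Zx.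
    by have [_ ->] := centQtP _ Rx; rewrite eqxx.
  exists (Some (exist (fun D => is_dent G Q L D) _ (is_dent_dent_of Rx notZx))).
    by rewrite inE.
  by apply/esym/dent_map_dent_of.
by have [Rx _ _] := dent_eltP (valP D); apply: mem_quotient.
Qed.

Lemma dent_map_add d1 d2 : dent_map (dent_add d1 d2) = dent_map d1 * dent_map d2.
Proof.
case: d1 d2 => [D1|] [D2|]; rewrite /dent_add ?mul1g ?mulg1 //.
have [Rx notZx defD1] := dent_eltP (valP D1).
have [Ry notZy defD2] := dent_eltP (valP D2).
have [eqD | neqD] := eqVneq D1 D2.
  rewrite -eqD /= -morphM ?nZR //= coset_id // centQt_center.
  have [Qx xt] := centQtP _ Rx.
  by rewrite sq_center // conjMg xt eqxx.
set x := dent_elt _ in Rx notZx defD1; set y := dent_elt _ in Ry notZy defD2.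
(* Distinct dents have distinct images modulo [Z], so [x * y] defines a dent; hence [insub] succeeds
   on the diagonal. *)
have notZxy : x * y \notin Z.
  apply: mul_notin_center => //; apply: contra neqD => /eqP/eq_dent_of eqD.
  by rewrite -val_eqE /= defD1 defD2 eqD.
have Rxy := groupM Rx Ry.
have defDD : diagonal Q L (val D1) (val D2) = dent_of (x * y).
  by rewrite defD1 defD2 diagonal_dent_of.
have dDD : is_dent G Q L (diagonal Q L (val D1) (val D2)).
  by rewrite defDD is_dent_dent_of.
rewrite insubT [LHS](dent_map_dent_of Rxy notZxy) //=.
by rewrite (morphM _ (nZR Rx) (nZR Ry)).
Qed.

(** Both forms test whether the chosen element of [R] squares to 1. *)
Lemma dent_map_q d : q_t (dent_map d) = dent_q d.
Proof.
case: d => [D|] /=.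
  have [Rx notZx defD] := dent_eltP (valP D).
  by rewrite q_tE ?card_centQt_center // {2}defD singular_dent_of.
by rewrite -(coset_id (group1 ZR)) q_tE ?card_centQt_center ?group1 // expg1n eqxx.
Qed.

End Dents.

Theorem lemma6p3 (gT : finGroupType) (m : nat) (G Q L : {group gT}) (s t : gT)
    (hG : biextraspecial m G Q) (hL : Q ><| L = G)
    (ht : t \in L) (ot : #[t] = 2) (os : #[s] = 3)
    (hst : L :=: <<[set s; t]>>) :
  let R := 'C_Q[t]%G in
  exists f : dent_space G Q L -> coset_of 'Z(R),
    (* f is the map sending zero to Z_t and D = <x, y, Z> to Z_t x *)
    (f None = 1 /\
     forall (D : dent G Q L) (v : coset_of 'Z(R)),
       f (Some D) = v <->
       exists a b x y, standard_basis Q s t (val D) a b x y /\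
                       v = coset 'Z(R) x) /\
    (* bijective onto R / Z_t, linear over GF(2), and an isometry *)
    [/\ injective f,
        [set f d | d in [set: dent_space G Q L]] = R / 'Z(R),
        forall d1 d2, f (dent_add d1 d2) = f d1 * f d2
      & forall d, q_t (f d) = dent_q d].
Proof.
exists (@dent_map _ G Q L t); split.
  by split=> // D v; apply: (dent_mapP hG hL ht ot os hst).
split.
- exact: (dent_map_inj hG hL ht ot os hst).
- exact: (dent_map_im hG hL ht ot os hst).
- exact: (dent_map_add hG hL ht ot os hst).
- exact: (dent_map_q hG hL ht ot os hst).
Qed.
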